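(* Let $k$ be a field of characteristic $0$ and let $P$ be a locally finite poset. The Maurer–Cartan moduli space $\mathscr{MC}(\lambda C^\bullet(P;k)[[\lambda]])$ is isomorphic, as a pointed set, to the cohomology group $H^2(P;W)$ of the poset $P$ with coefficients in the group $W$ of big Witt vectors: $$\mathscr{MC}(\lambda C^\bullet(P;k)[[\lambda]])\cong H^2(P;W).$$
   Context: A poset $P$ is locally finite if $\{x\in P\mid x_1\le x\le x_2\}$ is finite for all $x_1,x_2\in P$. $C^n(P;k)$ is the space of all $k$-valued functions on $n$-simplices $(v_0,\ldots,v_n)$, $v_0\le\cdots\le v_n$, of the nerve of $P$ viewed as a category (degenerate simplices included). $m_{\mathrm S}\in C^2(P;k)$ is the constant cochain $1$. DGLA structure: give $f\in C^p(P;k)$ the shifted degree $|f|=p-1$. For $f\in C^p$, $g\in C^q$ put $f\circ g=\sum_{j=1}^p(-1)^{(j-1)(q-1)}f\circ_jg$, where $(f\circ_jg)(v_0,\ldots,v_{p+q-1})=f(v_0,\ldots,v_{j-1},v_{j+q-1},\ldots,v_{p+q-1})\,g(v_{j-1},\ldots,v_{j+q-1})$; the bracket is $[f,g]=f\circ g-(-1)^{|f||g|}g\circ f$ and the differential is $d=[m_{\mathrm S},-]$. $\lambda C^\bullet(P;k)[[\lambda]]$ denotes power series in $\lambda$ with zero constant term and coefficients in $C^\bullet(P;k)$, with the $\lambda$-linearly extended DGLA structure in the shifted grading: its degree-$0$ elements are series of 1-cochains, its degree-$1$ elements are series of 2-cochains. For a DGLA $\mathfrak g$, $\mathrm{MC}(\mathfrak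 g)=\{a\in\mathfrak g^1\mid da+\frac12[a,a]=0\}$. Let $\Omega_n=k[t_0,\ldots,t_n,dt_0,\ldots,dt_n]/(\sum t_i=1,\sum dt_i=0)$, $\deg t_i=0$, $\deg dt_i=1$ (a simplicial differential graded commutative algebra $\Omega_\bullet$), and $\mathrm{MC}_\bullet(\mathfrak g)=\mathrm{MC}(\mathfrak g\otimes\Omega_\bullet)$ (with the $\lambda$-adically completed tensor product for $\mathfrak g=\lambda C^\bullet(P;k)[[\lambda]]$). The Maurer–Cartan moduli space is $\mathscr{MC}(\mathfrak g)=\pi_0(\mathrm{MC}_\bullet(\mathfrak g))$, a pointed set with base point $0$. It is known that for pro-nilpotent $\mathfrak g$ it can be identified with the orbit space $\mathrm{MC}(\mathfrak g)/\exp(\mathfrak g^0)$, where $\exp(\mathfrak g^0)$ is the group of formal symbols $\exp(x)$, $x\in\mathfrak g^0$, with Campbell–Baker–Hausdorff product, acting by the standard gauge action. $W=1+\lambda k[[\lambda]]$ is the abelian multiplicative group of the big Witt ring, and $H^2(P;W)$ is the second simplicial cohomology group of the nerve of $P$ with coefficients in the abelian group $W$, pointed by its identity element. *)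

(* Defs.v *)
From HB Require Import structures.
From mathcomp Require Import all_boot all_order all_algebra.
From mathcomp Require Import generic_quotient ring_quotient zify mpoly.
From mathcomp Require Import boolp classical_sets functions cardinality.
From Stdlib Require Import Relations.

Set Implicit Arguments.
Unset Strict Implicit.
Unset Printing Implicit Defensive.

Import Order.TTheory GRing.Theory.
Local Open Scope ring_scope.

Definition locally_finite (disp : Order.disp_t) (P : porderType disp) : Prop :=
  forall x1 x2 : P, finite_set [set x : P | (x1 <= x)%O && (x <= x2)%O].

(* Degenerate simplices are included: the chains are weakly increasing. *)
Definition simplex (disp : Order.disp_t) (P : porderType disp) (n : nat) :=
  {v : n.+1.-tuple P | sorted <=%O v}.

Definition cochain (disp : Order.disp_t) (P : porderType disp) (A : Type)
  (n : nat) := simplex P n -> A.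

Section Reindex.
Context {disp : Order.disp_t} {P : porderType disp}.

Lemma reindex_subproof (m n : nat) (th : nat -> nat)
    (hth : {homo th : i j / (i <= j)%N}) (v : simplex P n) :
  sorted <=%O [tuple tnth (val v) (inord (minn n (th i))) | i < m.+1].
Proof.
case: v => v /= vs.
have vle i j : (i <= j)%N -> (j < n.+1)%N ->
    (nth (thead v) v i <= nth (thead v) v j)%O.
  move=> ij jn; apply: (sorted_leq_nth le_trans le_refl _ vs) => //.
  - by rewrite inE size_tuple (leq_ltn_trans ij).
  - by rewrite inE size_tuple.
apply: (@homo_sorted _ _ _ (relpre (val : _ -> nat) leq)) => [i j /= ij|].
  rewrite !(tnth_nth (thead v)) !inordK ?ltnS ?geq_minl //; apply: vle.
    by rewrite leq_min geq_minl /= (leq_trans (geq_minr _ _)) ?hth.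
  by rewrite ltnS geq_minl.
by have := iota_sorted 0 m.+1; rewrite -val_enum_ord sorted_map.
Qed.

(* The m-simplex (v_{th 0}, ..., v_{th m}).  Values of th above n are clamped *)
(* to n; this never happens for the simplicial and cochain operations below.  *)
Definition reindex (m n : nat) (th : nat -> nat)
    (hth : {homo th : i j / (i <= j)%N}) (v : simplex P n) : simplex P m :=
  exist (fun v : m.+1.-tuple P => is_true (sorted <=%O v)) _
        (reindex_subproof m hth v).

End Reindex.

Lemma bump_homo (h : nat) : {homo bump h : i j / (i <= j)%N}.
Proof. by move=> i j ij; rewrite leq_bump2. Qed.

Section Cohomology.
Context {disp : Order.disp_t} {P : porderType disp}.
Variable A : zmodType.

Definition delta (n : nat) (f : cochain P A n) : cochain P A n.+1 :=
  fun v => \sum_(i < n.+2) f (reindex n (bump_homo i) v) *~ ((-1) ^+ i).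

Lemma deltaB (n : nat) : {morph @delta n : f g / (f - g : simplex P n -> A)
                             >-> (f - g : simplex P n.+1 -> A)}.
Proof.
move=> f g; apply/funext => v; apply: (@etrans _ _ (delta f v - delta g v)) => //.
by rewrite /delta -sumrB; apply: eq_bigr => i _; rewrite -mulrzBl.
Qed.

Definition is_cocycle (n : nat) : {pred (simplex P n -> A)} :=
  fun f => delta f == 0 :> (simplex P n.+1 -> A).

Lemma is_cocycle_zmod (n : nat) : zmod_closed (@is_cocycle n).
Proof.
have d0 : delta (0 : simplex P n -> A) = 0 :> (simplex P n.+1 -> A).
  by rewrite -[X in delta X](subrr 0) deltaB subrr.
split=> [|f g]; rewrite /in_mem /= /is_cocycle; first exact/eqP.
by move=> /eqP f0 /eqP g0; rewrite deltaB f0 g0 subrr.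
Qed.

HB.instance Definition _ (n : nat) :=
  GRing.isZmodClosed.Build (simplex P n -> A) (@is_cocycle n)
    (is_cocycle_zmod n).

Record cocycle (n : nat) := Cocycle {
  cocycle_val :> simplex P n -> A;
  cocycleP : cocycle_val \in @is_cocycle n }.
HB.instance Definition _ (n : nat) := [isSub for @cocycle_val n].
HB.instance Definition _ (n : nat) := [Choice of cocycle n by <:].
HB.instance Definition _ (n : nat) := [SubChoice_isSubZmodule of cocycle n by <:].

Definition is_coboundary (n : nat) : {pred cocycle n} :=
  match n return {pred cocycle n} with
  | 0 => fun z => z == 0
  | m.+1 => fun z => `[< exists b : cochain P A m, delta b = z >]
  end.

Lemma is_coboundary_zmod (n : nat) : zmod_closed (@is_coboundary n).
Proof.
case: n => [|n]; split; rewrite /in_mem /=.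
- exact: eqxx.
- by move=> y z; rewrite /in_mem /= => /eqP-> /eqP->; rewrite subrr.
- apply/asboolP; exists (0 : simplex P n -> A).
  by rewrite -[X in delta X](subrr 0) deltaB subrr.
- move=> y z; rewrite /in_mem /= => /asboolP[b hb] /asboolP[c hc]; apply/asboolP.
  by exists (b - c : simplex P n -> A); rewrite deltaB hb hc.
Qed.

HB.instance Definition _ (n : nat) :=
  GRing.isZmodClosed.Build (cocycle n) (@is_coboundary n)
    (is_coboundary_zmod n).

End Cohomology.

Definition cohomology (disp : Order.disp_t) (P : porderType disp)
    (A : zmodType) (n : nat) : zmodType :=
  Quotient.quot (@is_coboundary disp P A n : zmodClosed _).

(* The big Witt vectors: formal power series with constant term 1.  The group *)
(* law, written additively (it is the addition of the Witt ring), is the      *)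
(* multiplication of power series, with identity element the series 1.        *)
Record witt (k : fieldType) := Witt {
  wcoef :> nat -> k;
  wcoefP : wcoef 0%N == 1 }.
HB.instance Definition _ (k : fieldType) := [isSub for @wcoef k].
HB.instance Definition _ (k : fieldType) := [Choice of witt k by <:].

Section Witt.
Variable k : fieldType.
Implicit Types (f g h : nat -> k) (x y z : witt k).

Definition ps_mul f g : nat -> k := fun n => \sum_(i < n.+1) f i * g (n - i)%N.

Definition ps_one : nat -> k := fun n => (n == 0%N)%:R.

(* The first n+1 coefficients of the inverse of f, when f has constant term 1 *)
Fixpoint ps_inv_seq f (n : nat) : seq k :=
  if n is m.+1 then
    let s := ps_inv_seq f m in
    rcons s (- \sum_(i < m.+1) f i.+1 * s`_(m - i))
  else [:: 1].

Definition ps_inv f : nat -> k := fun n => (ps_inv_seq f n)`_n.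

Lemma size_ps_inv_seq f n : size (ps_inv_seq f n) = n.+1.
Proof. by elim: n => //= n IH; rewrite size_rcons IH. Qed.

Lemma nth_ps_inv_seq f n i : (i <= n)%N -> (ps_inv_seq f n)`_i = ps_inv f i.
Proof.
elim: n => [|n IH]; first by rewrite leqn0 => /eqP->.
rewrite leq_eqVlt => /orP[/eqP->//|lin].
by rewrite /= nth_rcons size_ps_inv_seq lin IH.
Qed.

Lemma ps_invS f n :
  ps_inv f n.+1 = - \sum_(i < n.+1) f i.+1 * ps_inv f (n - i)%N.
Proof.
rewrite /ps_inv /= nth_rcons size_ps_inv_seq ltnn eqxx.
by congr (- _); apply: eq_bigr => i _; rewrite nth_ps_inv_seq ?leq_subr.
Qed.

Lemma ps_mul_poly f g n N : (n <= N)%N ->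
  ps_mul f g n = ((\poly_(i < N.+1) f i) * (\poly_(i < N.+1) g i))`_n.
Proof.
move=> nN; rewrite coefM; apply: eq_bigr => i _.
rewrite !coef_poly !ltnS (leq_trans (leq_subr _ _) nN).
by rewrite (leq_trans _ nN) // -ltnS.
Qed.

Lemma ps_mulC : commutative ps_mul.
Proof.
by move=> f g; apply/funext => n; rewrite !(ps_mul_poly _ _ (leqnn n)) mulrC.
Qed.

Lemma ps_mulA : associative ps_mul.
Proof.
move=> f g h; apply/funext => n.
pose F u := \poly_(i < n.+1) u i : {poly k}.
suff E u v w : ps_mul u (ps_mul v w) n = (F u * (F v * F w))`_n.
  by rewrite (ps_mulC (ps_mul f g)) !E mulrA (mulrC (F h)).
rewrite coefM; apply: eq_bigr => i _; rewrite coef_poly ltn_ord.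
by rewrite (ps_mul_poly _ _ (leq_subr i n)).
Qed.

Lemma ps_mul1 : left_id ps_one ps_mul.
Proof.
move=> f; apply/funext => n; rewrite /ps_mul big_ord_recl /ps_one mul1r subn0.
by rewrite big1 ?addr0 // => i _; rewrite mul0r.
Qed.

Lemma ps_mulV f : f 0%N = 1 -> ps_mul (ps_inv f) f = ps_one.
Proof.
move=> f0; rewrite ps_mulC; apply/funext => -[|n].
  by rewrite /ps_mul big_ord1 f0 mulr1.
rewrite /ps_mul big_ord_recl f0 mul1r subn0 ps_invS addNr.
by [].
Qed.

Lemma witt_mul_subproof x y : ps_mul x y 0%N == 1.
Proof. by rewrite /ps_mul big_ord1 !(eqP (wcoefP _)) mulr1. Qed.
Definition witt_add x y := Witt (witt_mul_subproof x y).

Lemma witt_one_subproof : ps_one 0%N == 1.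
Proof. by []. Qed.
Definition witt_zero := Witt witt_one_subproof.

Lemma witt_inv_subproof x : ps_inv x 0%N == 1.
Proof. by []. Qed.
Definition witt_opp x := Witt (witt_inv_subproof x).

Lemma witt_addA : associative witt_add.
Proof. by move=> x y z; apply/val_inj/ps_mulA. Qed.

Lemma witt_addC : commutative witt_add.
Proof. by move=> x y; apply/val_inj/ps_mulC. Qed.

Lemma witt_add0 : left_id witt_zero witt_add.
Proof. by move=> x; apply/val_inj/ps_mul1. Qed.

Lemma witt_addN : left_inverse witt_zero witt_opp witt_add.
Proof. by move=> x; apply/val_inj/ps_mulV/eqP/wcoefP. Qed.

HB.instance Definition _ :=
  GRing.isZmodule.Build (witt k) witt_addA witt_addC witt_add0 witt_addN.

End Witt.

(* Omega_n = k[t_0..t_n, dt_0..dt_n] / (sum t_i = 1, sum dt_i = 0), with t_0  *)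
(* and dt_0 eliminated: w stands for sum_S (w S) dt_S, where S ranges over    *)
(* the subsets of {1..n} (shifted to 'I_n), dt_S is the product of the dt_i,  *)
(* i in S, in increasing order, and w S is a polynomial in t_1..t_n.          *)
Definition Omega (k : fieldType) (n : nat) := {ffun {set 'I_n} -> {mpoly k[n]}}.
HB.instance Definition _ (k : fieldType) (n : nat) :=
  GRing.Lmodule.on (Omega k n).

Section Omega.
Variable k : fieldType.

(* dt_T dt_U = (-1)^(ninv T U) dt_(T U) for disjoint T and U *)
Definition ninv (n : nat) (T U : {set 'I_n}) : nat :=
  #|[set ij : 'I_n * 'I_n | [&& ij.1 \in T, ij.2 \in U & (ij.2 < ij.1)%N]]|.

Definition Omega_mul (n : nat) (a b : Omega k n) : Omega k n :=
  [ffun S : {set 'I_n} => \sum_(T : {set 'I_n} | T \subset S)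
     (-1) ^+ ninv T (S :\: T) *: (a T * b (S :\: T))].

Definition Omega_const (n : nat) (p : {mpoly k[n]}) : Omega k n :=
  [ffun S : {set 'I_n} => if S == finset.set0 then p else 0].

Definition Omega_one (n : nat) : Omega k n := Omega_const 1.

(* d (p dt_U) = sum_i (dp/dt_i) dt_i dt_U *)
Definition Omega_diff (n : nat) (a : Omega k n) : Omega k n :=
  [ffun S : {set 'I_n} => \sum_(i in S)
     (-1) ^+ ninv [set i] (S :\ i) *: mderiv i (a (S :\ i))].

Definition bary_coord (n : nat) (i : 'I_n.+1) : {mpoly k[n]} :=
  if unlift ord0 i is Some j then 'X_j else 1 - \sum_(j < n) 'X_j.

Definition bary_coord_pull (m n : nat) (th : 'I_m.+1 -> 'I_n.+1) (i : 'I_n.+1) :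
    {mpoly k[m]} :=
  \sum_(j < m.+1 | th j == i) bary_coord j.

(* The simplicial operator of th : [m] -> [n] (meant for monotone th): the    *)
(* morphism of differential graded algebras Omega_n -> Omega_m which maps t_i *)
(* to the sum of the t_j such that th j = i.                                  *)
Definition Omega_map (m n : nat) (th : 'I_m.+1 -> 'I_n.+1) (w : Omega k n) :
    Omega k m :=
  \sum_(S : {set 'I_n})
    Omega_mul
      (Omega_const
         (comp_mpoly [tuple bary_coord_pull th (lift ord0 i) | i < n] (w S)))
      (\big[@Omega_mul m/Omega_one m]_(i in S)
         Omega_diff (Omega_const (bary_coord_pull th (lift ord0 i)))).

End Omega.

(* The shifted degree |f| = p - 1 of a p-cochain f *)
Definition shdeg (p : nat) : int := p%:Z - 1.

Lemma outer_homo (j q : nat) :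
  {homo (fun i => if (i < j)%N then i else (i + q).-1) : x y / (x <= y)%N}.
Proof. by move=> x y xy; case: (ltnP x j); case: (ltnP y j); lia. Qed.

Lemma inner_homo (j : nat) :
  {homo (fun i => (j.-1 + i)%N) : x y / (x <= y)%N}.
Proof. by move=> x y xy; rewrite leq_add2l. Qed.

Section Gerstenhaber.
Context {disp : Order.disp_t} {P : porderType disp}.
Variables (k : fieldType) (A : lmodType k).

(* Operations on cochains with coefficients in A, with respect to a product   *)
(* mul on A.  When A = k they are the operations of C(P; k).  The target      *)
(* degree n is a parameter, meant to be p + q - 1.                            *)
Definition circ_at (mul : A -> A -> A) (n j p q : nat)
    (f : cochain P A p) (g : cochain P A q) : cochain P A n :=
  fun v => mul (f (reindex p (@outer_homo j q) v))
               (g (reindex q (@inner_homo j) v)).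
Arguments circ_at mul n j {p q} f g v.

Definition circ (mul : A -> A -> A) (n p q : nat)
    (f : cochain P A p) (g : cochain P A q) : cochain P A n :=
  fun v => \sum_(1 <= j < p.+1)
    ((-1) ^ ((j%:Z - 1) * shdeg q)) *: circ_at mul n j f g v.
Arguments circ mul n {p q} f g v.

(* The product of the coefficients of f and g is always taken in this order,  *)
(* so that [f (x) a, g (x) b] below is [f, g] (x) (mul a b).                  *)
Definition bracket (mul : A -> A -> A) (n p q : nat)
    (f : cochain P A p) (g : cochain P A q) : cochain P A n :=
  fun v => circ mul n f g v
    - ((-1) ^ (shdeg p * shdeg q)) *: circ (fun x y => mul y x) n g f v.

End Gerstenhaber.
Arguments circ_at {disp P k A} mul n j {p q} f g v.
Arguments circ {disp P k A} mul n {p q} f g v.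
Arguments bracket {disp P k A} mul n {p q} f g v.

Section MaurerCartan.
Context {disp : Order.disp_t} (P : porderType disp) (k : fieldType).

(* Families of Omega_n-valued cochains: the coefficient of lambda^j of        *)
(* a : lambda_series n has the component a j p on p-simplices.                *)
Definition lambda_series (n : nat) := nat -> forall p, cochain P (Omega k n) p.
HB.instance Definition _ (n : nat) := Choice.on (lambda_series n).

(* The pure tensor f (x) w is the function v |-> f v *: w.  This identifies   *)
(* C^p(P; k) (x) Omega_n with the functions that are finite sums of pure      *)
(* tensors, and the lambda-adically completed tensor product of               *)
(* lambda C(P; k)[[lambda]] and Omega_n with the sequences of such functions  *)
(* which have no term in lambda^0.                                            *)
Definition in_tensor (n p : nat) (f : cochain P (Omega k n) p) : Prop :=
  exists s : seq (cochain P k p * Omega k n),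
    forall v, f v = \sum_(cw <- s) cw.1 v *: cw.2.

Definition has_degree (n : nat) (e : int) (a : lambda_series n) : Prop :=
  forall j p v (S : {set 'I_n}), a j p v S != 0 -> shdeg p + #|S|%:Z = e.

(* The homogeneous part of degree e *)
Definition in_gOmega (n : nat) (e : int) (a : lambda_series n) : Prop :=
  [/\ forall p v, a 0%N p v = 0,
      forall j p, in_tensor (a j p) & has_degree e a].

(* w |-> (-1)^(z |w|) w *)
Definition koszul (n : nat) (z : int) (w : Omega k n) : Omega k n :=
  [ffun S : {set 'I_n} => ((-1) ^ (#|S|%:Z * z)) *: w S].

(* [f (x) w, g (x) w'] = (-1)^(|w| |g|) [f, g] (x) w w' *)
Definition lambda_bracket (n : nat) (a b : lambda_series n) : lambda_series n :=
  fun j m v => \sum_(i < j.+1) \sum_(p < m.+2)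
    bracket (@Omega_mul k n) m
      (fun u => koszul (shdeg (m.+1 - p)) (a i p u))
      (b (j - i)%N (m.+1 - p)%N) v.

Definition mS (n : nat) : cochain P (Omega k n) 2 := fun=> Omega_one k n.

(* d (f (x) w) = [mS, f] (x) w + (-1)^|f| f (x) dw *)
Definition lambda_diff (n : nat) (a : lambda_series n) : lambda_series n :=
  fun j m v =>
    (if m is p.+1 then bracket (@Omega_mul k n) m (@mS n) (a j p) v else 0)
    + ((-1) ^ shdeg m) *: Omega_diff (a j m v).

Arguments lambda_bracket {n} a b _ _ _.
Arguments lambda_diff {n} a _ _ _.

Definition maurer_cartan (n : nat) (a : lambda_series n) : Prop :=
  in_gOmega 1 a /\
  forall j p v,
    lambda_diff a j p v + 2%:R^-1 *: lambda_bracket a a j p v = 0.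

(* MC_n, the set of n-simplices of MC_bullet *)
Record MC (n : nat) := MkMC {
  MC_val :> lambda_series n;
  MCP : `[< maurer_cartan MC_val >] }.
HB.instance Definition _ (n : nat) := [isSub for @MC_val n].
HB.instance Definition _ (n : nat) := [Choice of MC n by <:].

Definition lambda_map (m n : nat) (th : 'I_m.+1 -> 'I_n.+1)
    (a : lambda_series n) : lambda_series m :=
  fun j p v => Omega_map th (a j p v).
Arguments lambda_map {m n} th a _ _ _.

(* The i-th face, induced by the injection [n] -> [n+1] which omits i *)
Definition MC_face (n : nat) (i : 'I_n.+2) :
    lambda_series n.+1 -> lambda_series n :=
  lambda_map (lift i).

Definition MC_edge (x y : MC 0) : Prop :=
  exists c : MC 1, MC_face ord_max c = x /\ MC_face ord0 c = y.

Definition MC_connected (x y : MC 0) : bool :=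
  `[< clos_refl_sym_trans (MC 0) MC_edge x y >].

Lemma MC_connected_equiv : equiv_class_of MC_connected.
Proof.
split=> [x|x y|y x z].
- exact/asboolP/rst_refl.
- by apply/asboolP/asboolP; apply: rst_sym.
- by move=> /asboolP xy /asboolP yz; apply/asboolP; apply: rst_trans xy yz.
Qed.

Canonical MC_connected_equivRel := EquivRelPack MC_connected_equiv.

(* The Maurer-Cartan moduli space: the quotient of MC_0 by the equivalence    *)
(* relation generated by the edges, that is, pi_0 of MC_bullet                *)
Definition MCmoduli := {eq_quot MC_connected_equivRel}%qT.

Lemma MC_zero_subproof (n : nat) :
  `[< maurer_cartan ((fun _ _ _ => 0) : lambda_series n) >].
Proof.
apply/asboolP; split; first split=> //.
- by move=> j p; exists [::] => v; rewrite big_nil.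
- by move=> j p v S; rewrite ffunE eqxx.
have omul0 (x : Omega k n) : Omega_mul 0 x = 0.
  by apply/ffunP => S; rewrite !ffunE big1 // => T _; rewrite ffunE mul0r scaler0.
have omulr0 (x : Omega k n) : Omega_mul x 0 = 0.
  by apply/ffunP => S; rewrite !ffunE big1 // => T _; rewrite ffunE mulr0 scaler0.
have brk0 m p q (f : cochain P _ p) :
    bracket (@Omega_mul k n) m f ((fun=> 0) : cochain P _ q) = fun=> 0.
  apply/funext => v; rewrite /bracket /circ /circ_at !big1 ?scaler0 ?subr0 //.
    by move=> i _; rewrite omulr0 scaler0.
  by move=> i _; rewrite omulr0 scaler0.
move=> j p v; rewrite /lambda_bracket big1 ?scaler0 ?addr0 => [|i _]; last first.
  by rewrite big1 // => q _; rewrite brk0.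
have diff0 : Omega_diff (0 : Omega k n) = 0.
  apply/ffunP => S; rewrite !ffunE big1 // => T _.
  by rewrite ffunE raddf0 scaler0.
rewrite /lambda_diff diff0 scaler0 addr0.
by case: p v => // p v; rewrite brk0.
Qed.

Definition MC_zero (n : nat) : MC n := MkMC (MC_zero_subproof n).

Definition MCmoduli_base : MCmoduli := \pi_MCmoduli%qT (MC_zero 0).

End MaurerCartan.
Arguments lambda_bracket {disp P k n} a b _ _ _.
Arguments lambda_diff {disp P k n} a _ _ _.
Arguments lambda_map {disp P k m n} th a _ _ _.

(* Main.v *)
(* Write an element of degree 1 of lambda C(P; k)[[lambda]] as a series a
   of 2-cochains. The Maurer-Cartan equation says that 1 + a is a
   multiplicative 2-cocycle with values in W = 1 + lambda k[[lambda]]. An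
   edge of the simplicial set MC is a pair a(t) + b(t) dt, where b is a
   series of 1-cochains, and its Maurer-Cartan equation says that 1 + a(t)
   is a cocycle for each t and that (1 + a)' = (1 + a) (b(v1, v2) - b(v0,
   v2) + b(v0, v1)). If u is the solution of u' = u b with u(0) = 1, then
   1 + a(t) and (1 + a(0)) times the coboundary of u(t) solve the same
   linear differential equation and agree at t = 0, so the end points of
   an edge are cohomologous. Conversely, if g differs from f by the
   coboundary of w, set u(t) = 1 + t (w - 1); then f times the coboundary
   of u(t), together with b = u' / u, is an edge from f to g. *)
From HB Require Import structures.
From mathcomp Require Import all_boot all_order all_algebra.
From mathcomp Require Import generic_quotient ring_quotient zify ring mpoly.
From mathcomp Require Import boolp functions.
From Stdlib Require Import Relations.
Require Import Defs.

Set Implicit Arguments.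
Unset Strict Implicit.
Unset Printing Implicit Defensive.

Import GRing.Theory.
Local Open Scope ring_scope.

(** * Formal power series over a commutative ring *)

Lemma strong_rec_fun (T : Type) (x0 : T) (F : nat -> (nat -> T) -> T) :
    (forall n f g, (forall i, (i < n)%N -> f i = g i) -> F n f = F n g) ->
  exists f, forall n, f n = F n f.
Proof.
move=> Fext.
(* [s n] lists the first [n] values. [F] reads this list with default [x0] past its end, which is
   harmless because [F n] depends only on values below [n]. *)
pose s := fix s n :=
  if n is m.+1 then rcons (s m) (F m (nth x0 (s m))) else [::].
have size_s n : size (s n) = n by elim: n => //= n IH; rewrite size_rcons IH.
have nth_s m n : (m < n)%N -> nth x0 (s n) m = nth x0 (s m.+1) m.
  elim: n => // n IH; rewrite ltnS leq_eqVlt => /orP[/eqP->//|mn].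
  by rewrite -IH // [in LHS]/= nth_rcons size_s mn.
exists (fun n => nth x0 (s n.+1) n) => n.
by rewrite /= nth_rcons size_s ltnn eqxx; apply: Fext => i /nth_s.
Qed.

(** A separate name for the function type, so that it can carry the Cauchy product; only the
    additive structure is taken over from functions. *)
Definition fps (R : comNzRingType) := nat -> R.
HB.instance Definition _ (R : comNzRingType) :=
  GRing.Zmodule.copy (fps R) (nat -> R).

Section PowerSeries.
Variable R : comNzRingType.
Implicit Types f g h : fps R.

Definition fps_mul f g : fps R := fun n => \sum_(i < n.+1) f i * g (n - i)%N.

Definition fps_one : fps R := fun n => (n == 0%N)%:R.

Lemma fps_mul_poly f g n N : (n <= N)%N ->
  fps_mul f g n = ((\poly_(i < N.+1) f i) * (\poly_(i < N.+1) g i))`_n.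
Proof.
move=> nN; rewrite coefM; apply: eq_bigr => i _.
rewrite !coef_poly !ltnS (leq_trans (leq_subr _ _) nN).
by rewrite (leq_trans _ nN) // -ltnS.
Qed.

Lemma fps_mulC : commutative fps_mul.
Proof.
by move=> f g; apply/funext => n; rewrite !(fps_mul_poly _ _ (leqnn n)) mulrC.
Qed.

Lemma fps_mulA : associative fps_mul.
Proof.
move=> f g h; apply/funext => n.
pose F u := \poly_(i < n.+1) u i : {poly R}.
suff E u v w : fps_mul u (fps_mul v w) n = (F u * (F v * F w))`_n.
  by rewrite (fps_mulC (fps_mul f g)) !E mulrA (mulrC (F h)).
rewrite coefM; apply: eq_bigr => i _; rewrite coef_poly ltn_ord.
by rewrite (fps_mul_poly _ _ (leq_subr i n)).
Qed.

Lemma fps_mul1 : left_id fps_one fps_mul.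
Proof.
move=> f; apply/funext => n; rewrite /fps_mul big_ord_recl /fps_one mul1r subn0.
by rewrite big1 ?addr0 // => i _; rewrite mul0r.
Qed.

Lemma fps_mulDl : left_distributive fps_mul +%R.
Proof.
move=> f g h; apply/funext => n; rewrite [RHS]/GRing.add /=.
rewrite /fps_mul -big_split /=.
by apply: eq_bigr => i _; apply: mulrDl.
Qed.

Lemma fps_one_neq0 : fps_one != 0.
Proof.
by apply/eqP => /(congr1 (fun f => f 0%N))/eqP; rewrite /fps_one oner_eq0.
Qed.

HB.instance Definition _ := GRing.Zmodule_isComNzRing.Build (fps R)
  fps_mulA fps_mulC fps_mul1 fps_mulDl fps_one_neq0.

Lemma fps_addE f g n : (f + g) n = f n + g n.
Proof. by []. Qed.

Lemma fps_oppE f n : (- f) n = - f n.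
Proof. by []. Qed.

Lemma fps_oneE n : (1 : fps R) n = (n == 0%N)%:R.
Proof. by []. Qed.

Lemma fps_mulE f g n : (f * g) n = \sum_(i < n.+1) f i * g (n - i)%N.
Proof. by []. Qed.

Lemma fps_mul0E f g : (f * g) 0%N = f 0%N * g 0%N.
Proof. by rewrite fps_mulE big_ord1. Qed.

End PowerSeries.

Section PowerSeriesMap.
Variables R S : comNzRingType.

Definition fps_map (phi : R -> S) (f : fps R) : fps S := fun n => phi (f n).

Variable phi : {rmorphism R -> S}.

Lemma fps_map_is_zmod_morphism : zmod_morphism (fps_map phi).
Proof. by move=> f g; apply/funext => n; rewrite /fps_map fps_addE rmorphB. Qed.

Lemma fps_map_is_monoid_morphism : monoid_morphism (fps_map phi).
Proof.
split=> [|f g]; apply/funext => n; rewrite /fps_map.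
  by rewrite fps_oneE rmorph_nat.
rewrite !fps_mulE rmorph_sum; apply: eq_bigr => i _; exact: rmorphM.
Qed.

HB.instance Definition _ := GRing.isZmodMorphism.Build (fps R) (fps S)
  (fps_map phi) fps_map_is_zmod_morphism.
HB.instance Definition _ := GRing.isMonoidMorphism.Build (fps R) (fps S)
  (fps_map phi) fps_map_is_monoid_morphism.

End PowerSeriesMap.

Section PowerSeriesDerivation.
Variables (k : fieldType) (n : nat) (i : 'I_n).

Lemma fps_derivD (f g : fps {mpoly k[n]}) : fps_map (mderiv i) (f + g) =
  fps_map (mderiv i) f + fps_map (mderiv i) g.
Proof. by apply/funext => j; rewrite /fps_map /= fps_addE mderivD. Qed.

Lemma fps_derivN (f : fps {mpoly k[n]}) :
  fps_map (mderiv i) (- f) = - fps_map (mderiv i) f.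
Proof. by apply/funext => j; rewrite /fps_map /= fps_oppE mderivN. Qed.

Lemma fps_deriv1 : @fps_map {mpoly k[n]} {mpoly k[n]} (mderiv i) 1 = 0.
Proof.
by apply/funext => j; rewrite /fps_map fps_oneE -mpolyC_nat mderivC.
Qed.

Lemma fps_derivM (f g : fps {mpoly k[n]}) : fps_map (mderiv i) (f * g) =
  fps_map (mderiv i) f * g + f * fps_map (mderiv i) g.
Proof.
apply/funext => j; rewrite /fps_map fps_addE !fps_mulE raddf_sum -big_split.
by apply: eq_bigr => l _; apply: mderivM.
Qed.

End PowerSeriesDerivation.

(** * Linear differential equations on the interval *)

Section Interval.
Variable k : fieldType.
Hypothesis k_char0 : [pchar k] =i pred0.
Implicit Types p q : {mpoly k[1]}.

Lemma natr_neq0 n : (n%:R == 0 :> k) = (n == 0%N).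
Proof. by move/pcharf0P: k_char0. Qed.

(** Integrate term by term; characteristic 0 allows the division by the exponent plus one. *)
Lemma mderiv_surj p : exists q, mderiv ord0 q = p.
Proof.
exists (\sum_(m <- msupp p)
  (p@_m / (m ord0).+1%:R) *: 'X_[m + mnm1 ord0]).
rewrite raddf_sum [RHS]mpolyE; apply: eq_bigr => m _ /=.
rewrite mderivZ mderivX scalerA addmK mnmDE mnm1E eqxx addn1 divfK //.
by rewrite natr_neq0.
Qed.

(** A monomial of positive exponent in the support of [p] would leave its coefficient times that
    exponent in the derivative, and this is nonzero in characteristic 0. *)
Lemma mderiv_eq0 p : mderiv ord0 p = 0 -> p = (p@_0)%:MP.
Proof.
move=> dp0; apply: msize1_polyC; rewrite msizeE.
apply/bigmax_leqP_seq => m mp _.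
rewrite ltnS mdegE big_ord1 leqNgt; apply/negP => m_gt0.
have mE : (m - mnm1 ord0 + mnm1 ord0)%MM = m.
  by apply: submK; apply/mnm_lepP => i; rewrite mnm1E; case: eqP => // <-.
have := congr1 (mcoeff (m - mnm1 ord0)%MM) dp0.
rewrite mcoeff_deriv mE mcoeff0 => /eqP.
rewrite -mulr_natr mulf_eq0 natr_neq0 orbF mcoeff_eq0.
by rewrite mp.
Qed.

(** As [b] has no constant term, the derivative of [f n] only involves [f i] with [i < n]. These
    vanish by induction, so [f n] is a constant, and its value at [t0] is 0. *)
Lemma fps_ode_eq0 (f b : fps {mpoly k[1]}) (t0 : 'I_1 -> k) :
    b 0%N = 0 -> fps_map (mderiv ord0) f = f * b -> fps_map (meval t0) f = 0 ->
  f = 0.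
Proof.
move=> b0 df f0; apply/funext => n; elim/ltn_ind: n => n IH.
have /mderiv_eq0 fn : mderiv ord0 (f n) = 0.
  rewrite -[LHS]/(fps_map (mderiv ord0) f n) df fps_mulE big_ord_recr /=.
  by rewrite subnn b0 mulr0 addr0 big1 // => i _; rewrite IH // mul0r.
have c0 : (f n)@_0 = 0.
  by rewrite -[LHS](mevalC t0) -fn; exact: (congr1 (fun g => g n) f0).
by rewrite [LHS]fn c0 mpolyC0.
Qed.

(** Solve order by order: since [b 0 = 0], the right-hand side at order [n] is already known, and
    [f n] is its primitive that vanishes at [t0]. *)
Lemma fps_ode_sol (b : fps {mpoly k[1]}) (t0 : 'I_1 -> k) : b 0%N = 0 ->
  exists f : fps {mpoly k[1]},
    [/\ f 0%N = 1, fps_map (mderiv ord0) f = f * b & fps_map (meval t0) f = 1].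
Proof.
move=> b0.
pose prim p := projT1 (cid (mderiv_surj p)).
have primE p : mderiv ord0 (prim p) = p by rewrite /prim; case: cid.
pose F n (f : nat -> {mpoly k[1]}) :=
  if n is m.+1 then
    let q := prim (\sum_(i < n) f i * b (n - i)%N) in q - (q.@[t0])%:MP
  else 1.
have [|f fE] := @strong_rec_fun _ 0 F.
  case=> //= n f g fg; congr (prim _ - (prim _).@[t0]%:MP);
  by apply: eq_bigr => i _; rewrite fg.
exists f; split; first by rewrite fE.
  apply/funext => n; rewrite fps_mulE big_ord_recr /= subnn b0 mulr0 addr0.
  case: n => [|n]; rewrite /fps_map fE /=.
    by rewrite -mpolyC1 mderivC big_ord0.
  by rewrite mderivB mderivC subr0 primE.
apply/funext => -[|n]; rewrite /fps_map fE /= ?meval1 //.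
by rewrite mevalB mevalC subrr.
Qed.

End Interval.

(** * Polynomial coefficients of bounded degree, and straight paths *)

Section Graded.
Variables (k : fieldType) (n : nat).

(* This bounds the degree in t of each coefficient uniformly over all simplices,
   which is what membership in the tensor product amounts to. *)
Definition graded (f : fps {mpoly k[n]}) : Prop :=
  forall j, (msize (f j) <= j.+1)%N.

Lemma msizeM_leS (p q : {mpoly k[n]}) (c d : nat) :
  (msize p <= c.+1)%N -> (msize q <= d.+1)%N -> (msize (p * q) <= (c + d).+1)%N.
Proof.
have [->|p0] := eqVneq p 0; first by rewrite mul0r msize0.
have [->|q0] := eqVneq q 0; first by rewrite mulr0 msize0.
move=> pc qd; rewrite msizeM // -[(c + d).+1]/((c.+1 + d).+1.-1) -addnS.
by rewrite -!subn1 leq_sub2r // leq_add.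
Qed.

Lemma msize_sum_le (I : finType) (F : I -> {mpoly k[n]}) (d : nat) :
  (forall i, (msize (F i) <= d)%N) -> (msize (\sum_i F i) <= d)%N.
Proof.
by move=> Fd; apply: leq_trans (msize_sum _ _ _) _; apply/bigmax_leqP.
Qed.

Lemma gradedM (f g : fps {mpoly k[n]}) : graded f -> graded g -> graded (f * g).
Proof.
move=> gf gg j; apply: msize_sum_le => i.
by have := msizeM_leS (gf i) (gg (j - i)%N); rewrite subnKC // -ltnS.
Qed.

Lemma gradedB (f g : fps {mpoly k[n]}) : graded f -> graded g -> graded (f - g).
Proof.
move=> gf gg j; apply: leq_trans (msizeD_le _ _) _.
by rewrite geq_max gf msizeN gg.
Qed.

Lemma graded_const (f : fps k) : graded (fps_map (@mpolyC n k) f).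
Proof. by move=> j; rewrite /fps_map msizeC; case: (_ != 0). Qed.

(** The recursion for the inverse combines [f i.+1] with [g (j - i)], whose degree bounds add up to
    [j.+1]. This keeps the logarithmic derivative of a path inside the tensor product. *)
Lemma graded_inv (f : fps {mpoly k[n]}) : f 0%N = 1 -> graded f ->
  exists g, [/\ g 0%N = 1, f * g = 1 & graded g].
Proof.
move=> f0 gf.
pose F j (g : nat -> {mpoly k[n]}) :=
  if j is m.+1 then - \sum_(i < m.+1) f i.+1 * g (m - i)%N else 1.
have [|g gE] := @strong_rec_fun _ 0 F.
  case=> //= j g h gh; congr (- _); apply: eq_bigr => i _.
  by rewrite gh // ltnS leq_subr.
exists g; split; first by rewrite gE.
  apply/funext => -[|j]; first by rewrite fps_mul0E f0 gE mulr1.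
  rewrite fps_mulE big_ord_recl f0 mul1r subn0 gE /=.
  by apply: etrans (addNr _) _.
elim/ltn_ind => -[|j] IH; first by rewrite gE msize1.
rewrite gE /= msizeN; apply: msize_sum_le => i.
have := msizeM_leS (gf i.+1) (IH (j - i)%N _).
by rewrite ltnS leq_subr => /(_ isT); rewrite addSn subnKC // -ltnS.
Qed.

End Graded.

(* The path 1 + t (f - 1) from 1 to f, for f with constant term 1 *)
Definition fps_path (k : fieldType) (f : fps k) : fps {mpoly k[1]} :=
  fun j => if j is 0 then 1 else 'X_ord0 * (f j)%:MP.

Section Path.
Variables (k : fieldType) (f : fps k).

Lemma graded_path : graded (fps_path f).
Proof.
move=> [|j] /=; first by rewrite msize1.
rewrite mulrC mul_mpolyC; apply: leq_trans (msizeZ_le _ _) _.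
by rewrite msizeX mdeg1.
Qed.

Lemma graded_deriv_path : graded (fps_map (mderiv ord0) (fps_path f)).
Proof.
move=> [|j] /=; rewrite /fps_map /=; first by rewrite -mpolyC1 mderivC msize0.
rewrite mulrC mderiv_mulC mderivX mnm1E eqxx -[X in 'X_[X - _]]add0m addmK.
rewrite mpolyX0 scale1r mulr1.
by rewrite msizeC; case: (_ != 0).
Qed.

Lemma deriv_path0 : fps_map (mderiv ord0) (fps_path f) 0%N = 0.
Proof. by rewrite /fps_map /= -mpolyC1 mderivC. Qed.

Lemma path_eval0 : fps_map (meval (fun=> 0)) (fps_path f) = 1.
Proof.
apply/funext => -[|j]; rewrite /fps_map ?meval1 //.
by rewrite mevalM mevalXU mul0r.
Qed.

Lemma path_eval1 : f 0%N = 1 -> fps_map (meval (fun=> 1)) (fps_path f) = f.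
Proof.
move=> f0; apply/funext => -[|j]; rewrite /fps_map ?meval1 //.
by rewrite mevalM mevalXU mul1r mevalC.
Qed.

End Path.

(** * Faces of simplices and the bracket in low degrees *)

Section Faces.
Variables (disp : Order.disp_t) (P : porderType disp).

Definition face (n : nat) (i : nat) (v : simplex P n.+1) : simplex P n :=
  reindex n (bump_homo i) v.

Lemma eq_reindex (m n : nat) (th th' : nat -> nat)
    (hth : {homo th : i j / (i <= j)%N}) (hth' : {homo th' : i j / (i <= j)%N})
    (v : simplex P n) :
    (forall i, (i <= m)%N -> th i = th' i) ->
  reindex m hth v = reindex m hth' v.
Proof.
move=> thE; apply: val_inj; apply: eq_from_tnth => i.
by rewrite !tnth_mktuple thE // -ltnS.
Qed.

Lemma reindex_id (n : nat) (th : nat -> nat)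
    (hth : {homo th : i j / (i <= j)%N}) (v : simplex P n) :
  (forall i, (i <= n)%N -> th i = i) -> reindex n hth v = v.
Proof.
move=> thE; apply: val_inj; apply: eq_from_tnth => i.
have ile : (i <= n)%N by rewrite -ltnS.
rewrite tnth_mktuple thE //; congr tnth; apply: val_inj.
by rewrite /= inordK (minn_idPr ile).
Qed.

Variables (k : fieldType) (A : lmodType k) (mul : A -> A -> A).
Hypothesis mul0x : forall x, mul 0 x = 0.
Hypothesis mulx0 : forall x, mul x 0 = 0.

Lemma bracket0l (n p q : nat) (f : cochain P A p) (g : cochain P A q) v :
  (forall u, f u = 0) -> bracket mul n f g v = 0.
Proof.
move=> f0; rewrite /bracket /circ /circ_at !big1 ?scaler0 ?subr0 // => i _.
  by rewrite f0 mul0x scaler0.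
by rewrite f0 mul0x scaler0.
Qed.

Lemma bracket0r (n p q : nat) (f : cochain P A p) (g : cochain P A q) v :
  (forall u, g u = 0) -> bracket mul n f g v = 0.
Proof.
move=> g0; rewrite /bracket /circ /circ_at !big1 ?scaler0 ?subr0 // => i _.
  by rewrite g0 mulx0 scaler0.
by rewrite g0 mulx0 scaler0.
Qed.

Lemma sum_1_2 (F : nat -> A) : \sum_(1 <= i < 3) F i = F 1%N + F 2%N.
Proof. by rewrite big_nat_recr //= big_nat1. Qed.

Local Ltac small_reindex := apply: eq_reindex => -[|[|[|]]].

(** Insertion at [j = 1] pairs the simplex without vertex 1 with (v0, v1, v2), and insertion at
    [j = 2] the one without vertex 2 with (v1, v2, v3), with sign -1. Both shifted degrees are 1, so
    the reversed composite enters with a plus sign. *)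
Lemma bracket22 (f g : cochain P A 2) (v : simplex P 3) :
  bracket mul 3 f g v =
    mul (f (face 1 v)) (g (face 3 v)) - mul (f (face 2 v)) (g (face 0 v))
    + (mul (f (face 3 v)) (g (face 1 v)) - mul (f (face 0 v)) (g (face 2 v))).
Proof.
have E1 : reindex 2 (@outer_homo 1 2) v = face 1 v by small_reindex.
have E2 : reindex 2 (@outer_homo 2 2) v = face 2 v by small_reindex.
have E3 : reindex 2 (@inner_homo 1) v = face 3 v by small_reindex.
have E0 : reindex 2 (@inner_homo 2) v = face 0 v by small_reindex.
rewrite /bracket /circ /circ_at !sum_1_2 ?big_nat1.
by rewrite E0 E1 E2 E3 expr0z !scale1r !expr1z !scaleN1r opprK.
Qed.

(** All signs of the composites are trivial, as [g] has shifted degree 0: the bracket is [f] times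
    the additive coboundary of [g]. *)
Lemma bracket21 (f : cochain P A 2) (g : cochain P A 1) (v : simplex P 2) :
  bracket mul 2 f g v =
    mul (f v) (g (face 2 v)) + mul (f v) (g (face 0 v))
    - mul (f v) (g (face 1 v)).
Proof.
have Eid j : reindex 2 (@outer_homo j 1) v = v.
  by apply: reindex_id => i _; case: ifP => // _; rewrite addn1.
have E0 : reindex 1 (@inner_homo 2) v = face 0 v by small_reindex.
have E2 : reindex 1 (@inner_homo 1) v = face 2 v by small_reindex.
have E1 : reindex 1 (@outer_homo 1 2) v = face 1 v by small_reindex.
have E : reindex 2 (@inner_homo 1) v = v by apply: reindex_id.
rewrite /bracket /circ /circ_at !sum_1_2 ?big_nat1.
by rewrite !Eid E E0 E1 E2 !mulr0 !mul0r !expr0z !scale1r.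
Qed.

Lemma bracket12 (f : cochain P A 1) (g : cochain P A 2) (v : simplex P 2) :
  bracket mul 2 f g v =
    mul (f (face 1 v)) (g v)
    - (mul (f (face 2 v)) (g v) + mul (f (face 0 v)) (g v)).
Proof.
have Eid j : reindex 2 (@outer_homo j 1) v = v.
  by apply: reindex_id => i _; case: ifP => // _; rewrite addn1.
have E0 : reindex 1 (@inner_homo 2) v = face 0 v by small_reindex.
have E2 : reindex 1 (@inner_homo 1) v = face 2 v by small_reindex.
have E1 : reindex 1 (@outer_homo 1 2) v = face 1 v by small_reindex.
have E : reindex 2 (@inner_homo 1) v = v by apply: reindex_id.
rewrite /bracket /circ /circ_at !sum_1_2 ?big_nat1.
by rewrite !Eid E E0 E1 E2 !mulr0 !mul0r !expr0z !scale1r.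
Qed.

End Faces.

(** * Polynomial forms on a point and on the interval *)

Section Forms.
Variables (k : fieldType) (n : nat).
Implicit Types p q : {mpoly k[n]}.
Implicit Types w : Omega k n.

(* For n = 1, this is the 1-form p dt_1; for n = 0, it is 0. *)
Definition Omega_top p : Omega k n :=
  [ffun S : {set 'I_n} => if S == finset.set0 then 0 else p].

Lemma ninv0r (T : {set 'I_n}) : ninv T finset.set0 = 0%N.
Proof.
by apply/eqP; rewrite cards_eq0; apply/eqP/setP => x; rewrite !inE andbF.
Qed.

Lemma ninv0l (T : {set 'I_n}) : ninv finset.set0 T = 0%N.
Proof. by apply/eqP; rewrite cards_eq0; apply/eqP/setP => x; rewrite !inE. Qed.

Lemma Omega_mul0l w : Omega_mul 0 w = 0.
Proof.
by apply/ffunP => S; rewrite !ffunE big1 // => T _; rewrite ffunE mul0r scaler0.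
Qed.

Lemma Omega_mul0r w : Omega_mul w 0 = 0.
Proof.
by apply/ffunP => S; rewrite !ffunE big1 // => T _; rewrite ffunE mulr0 scaler0.
Qed.

Lemma Omega_mul_constl p w S : Omega_mul (Omega_const p) w S = p * w S.
Proof.
rewrite ffunE (bigD1 finset.set0) ?finset.sub0set //=.
rewrite big1 => [|T /andP[_ /negPf T0]].
  by rewrite finset.setD0 ninv0l expr0 scale1r ffunE eqxx addr0.
by rewrite ffunE T0 mul0r scaler0.
Qed.

Lemma Omega_mul_constr p w S : Omega_mul w (Omega_const p) S = p * w S.
Proof.
rewrite ffunE (bigD1 S) //= big1 => [|T /andP[TS neTS]].
  by rewrite finset.setDv ninv0r expr0 scale1r ffunE eqxx addr0 mulrC.
rewrite ffunE finset.setD_eq0; case: ifP => [ST|].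
  by move: neTS; rewrite finset.eqEsubset TS ST.
by rewrite mulr0 scaler0.
Qed.

Lemma Omega_mul_const2 p q :
  Omega_mul (Omega_const p) (Omega_const q) = Omega_const (p * q).
Proof.
by apply/ffunP => S; rewrite Omega_mul_constl !ffunE; case: ifP; rewrite ?mulr0.
Qed.

Lemma Omega_mul_const_top p q :
  Omega_mul (Omega_const p) (Omega_top q) = Omega_top (p * q).
Proof.
by apply/ffunP => S; rewrite Omega_mul_constl !ffunE; case: ifP; rewrite ?mulr0.
Qed.

Lemma Omega_mul_top_const p q :
  Omega_mul (Omega_top p) (Omega_const q) = Omega_top (q * p).
Proof.
by apply/ffunP => S; rewrite Omega_mul_constr !ffunE; case: ifP; rewrite ?mulr0.
Qed.

Lemma Omega_const_is_linear : linear (@Omega_const k n).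
Proof.
move=> c p q; apply/ffunP => S; rewrite !ffunE; case: ifP => //.
by rewrite scaler0 addr0.
Qed.
HB.instance Definition _ := GRing.isLinear.Build k {mpoly k[n]} (Omega k n) _
  (@Omega_const k n) Omega_const_is_linear.

Lemma Omega_top_is_linear : linear Omega_top.
Proof.
move=> c p q; apply/ffunP => S; rewrite !ffunE; case: ifP => //.
by rewrite scaler0 addr0.
Qed.
HB.instance Definition _ := GRing.isLinear.Build k {mpoly k[n]} (Omega k n) _
  Omega_top Omega_top_is_linear.

Lemma Omega_constD : {morph @Omega_const k n : p q / p + q}.
Proof. exact: raddfD. Qed.

Lemma Omega_constB : {morph @Omega_const k n : p q / p - q}.
Proof. exact: raddfB. Qed.

Lemma Omega_topN : {morph Omega_top : p / - p}.
Proof. exact: raddfN. Qed.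

Lemma Omega_topD : {morph Omega_top : p q / p + q}.
Proof. exact: raddfD. Qed.

Lemma Omega_topB : {morph Omega_top : p q / p - q}.
Proof. exact: raddfB. Qed.

Lemma Omega_diff0 : Omega_diff (0 : Omega k n) = 0.
Proof.
apply/ffunP => S; rewrite !ffunE big1 // => T _.
by rewrite ffunE raddf0 scaler0.
Qed.

Lemma koszul0 z : koszul z (0 : Omega k n) = 0.
Proof. by apply/ffunP => S; rewrite !ffunE scaler0. Qed.

Lemma koszul_id w : koszul 0 w = w.
Proof. by apply/ffunP => S; rewrite !ffunE mulr0 expr0z scale1r. Qed.

Lemma koszul_const z p : koszul z (Omega_const p) = Omega_const p.
Proof.
apply/ffunP => S; rewrite !ffunE; case: eqP => [->|]; last by rewrite scaler0.
by rewrite cards0 mul0r expr0z scale1r.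
Qed.

Hypothesis n_le1 : (n <= 1)%N.

(** In dimension at most 1 a form thus has at most two components, so [Omega_const] and [Omega_top]
    describe all of them. *)
Lemma set_ord_le1 (S : {set 'I_n}) : S != finset.set0 -> S = [set: 'I_n]%SET.
Proof.
move=> /set0Pn[i iS]; apply/setP => j; rewrite !inE; suff -> : j = i by [].
by apply: val_inj; case: (i) (j) => [i' ?] [j' ?] /=; lia.
Qed.

Lemma card_ord_le1 (S : {set 'I_n}) : S != finset.set0 -> #|S| = 1%N.
Proof.
move=> S0; apply/eqP; rewrite eqn_leq card_gt0 S0 andbT.
by rewrite (leq_trans (max_card _)) // card_ord.
Qed.

Lemma koszul1_top p : koszul 1 (Omega_top p) = - Omega_top p.
Proof.
apply/ffunP => S; rewrite !ffunE; case: ifPn => [_|S0].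
  by rewrite scaler0 oppr0.
by rewrite card_ord_le1 // mulr1 expr1z scaleN1r.
Qed.

Lemma Omega_mul_top2 p q : Omega_mul (Omega_top p) (Omega_top q) = 0.
Proof.
apply/ffunP => S; rewrite !ffunE big1 // => T _; rewrite !ffunE.
case: ifPn => [_|T0]; first by rewrite mul0r scaler0.
case: ifPn => [_|S0]; first by rewrite mulr0 scaler0.
by move: S0; rewrite (set_ord_le1 T0) finset.setDT eqxx.
Qed.

(** The sum treats both dimensions at once: it is the derivative of [p] for [n = 1] and empty for
    [n = 0]. *)
Lemma Omega_diff_const p :
  Omega_diff (Omega_const p) = Omega_top (\sum_(i < n) mderiv i p).
Proof.
apply/ffunP => S; rewrite !ffunE.
case: ifPn => [/eqP->|S0]; first by rewrite big1 // => i; rewrite inE.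
rewrite (set_ord_le1 S0) big_mkcond; apply: eq_bigr => i _; rewrite inE.
have -> : [set: 'I_n]%SET :\ i = finset.set0 :> {set 'I_n}.
  apply/eqP; apply: contraT => /[dup] /set_ord_le1 E _.
  by have := finset.in_setT i; rewrite -E !inE eqxx.
by rewrite ninv0r expr0 scale1r ffunE eqxx.
Qed.

Lemma Omega_diff_top p : Omega_diff (Omega_top p) = 0.
Proof.
apply/ffunP => S; rewrite !ffunE big1 // => i iS; rewrite ffunE.
case: ifPn => [_|S0]; first by rewrite raddf0 scaler0.
by have := finset.in_setT i; rewrite -(set_ord_le1 S0) !inE eqxx.
Qed.

End Forms.

(** * The Maurer-Cartan equation, one cochain degree at a time *)

Section MCEquation.
Variables (disp : Order.disp_t) (P : porderType disp) (k : fieldType).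
Hypothesis k_char0 : [pchar k] =i pred0.
Variable n : nat.
Hypothesis n_le1 : (n <= 1)%N.
Variables (a : cochain P (fps {mpoly k[n]}) 2).
Variables (b : cochain P (fps {mpoly k[n]}) 1).

(* sum_j (a_j + b_j dt_1) lambda^j *)
Definition MC_series : lambda_series P k n := fun j p =>
  match p return cochain P (Omega k n) p with
  | 1 => fun v => Omega_top (b v j)
  | 2 => fun v => Omega_const (a v j)
  | _ => fun=> 0
  end.
Arguments MC_series : clear implicits.

Definition cocycle_defect (v : simplex P 3) : fps {mpoly k[n]} :=
  (1 + a (face 1 v)) * (1 + a (face 3 v))
  - (1 + a (face 2 v)) * (1 + a (face 0 v)).

Definition flow_defect (v : simplex P 2) : fps {mpoly k[n]} :=
  (1 + a v) * (b (face 2 v) + b (face 0 v) - b (face 1 v))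
  - fps_map (fun p => \sum_(i < n) mderiv i p) (a v).

Definition MC_lhs j m (v : simplex P m) := lambda_diff MC_series j m v
  + 2%:R^-1 *: lambda_bracket MC_series MC_series j m v.

(** In the bracket [q] is [m.+1 - p]; it is a separate argument here so that terms can be evaluated
    at numerals. *)
Definition MC_term j m (v : simplex P m) i p q := bracket (@Omega_mul k n) m
  (fun u : simplex P p => koszul (shdeg q) (MC_series i p u))
  (MC_series (j - i)%N q) v.

Arguments MC_lhs : clear implicits.
Arguments MC_term : clear implicits.

Lemma term0l j m (v : simplex P m) i p q :
  MC_series i p = (fun=> 0) -> MC_term j m v i p q = 0.
Proof.
move=> c0; apply: bracket0l => [x|u]; first by rewrite Omega_mul0l.
by rewrite c0 koszul0.
Qed.

Lemma term0r j m (v : simplex P m) i p q :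
  MC_series (j - i)%N q = (fun=> 0) -> MC_term j m v i p q = 0.
Proof.
move=> c0; apply: bracket0r => [x|u]; first by rewrite Omega_mul0r.
by rewrite c0.
Qed.

Lemma term11 j m (v : simplex P m) i : MC_term j m v i 1%N 1%N = 0.
Proof.
rewrite /MC_term /bracket /circ /circ_at !big_nat1 /= !koszul_id.
by rewrite !Omega_mul_top2 // !scaler0 subr0.
Qed.

Lemma lambda_bracketE j m v :
  lambda_bracket MC_series MC_series j m v =
    \sum_(i < j.+1) \sum_(p < m.+2) MC_term j m v i p (m.+1 - p)%N.
Proof. by []. Qed.

Lemma two_neq0 : 2%:R != 0 :> k.
Proof. by rewrite (natr_neq0 k_char0). Qed.

Lemma MC_lhs0 j v : MC_lhs j 0%N v = 0.
Proof.
rewrite /MC_lhs lambda_bracketE big1 => [|i _]; last first.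
  by rewrite !big_ord_recl big_ord0 /= term0l // term0r // !addr0.
by rewrite /lambda_diff /= Omega_diff0 !scaler0 !addr0.
Qed.

Lemma MC_lhs1 j v : MC_lhs j 1%N v = 0.
Proof.
rewrite /MC_lhs lambda_bracketE big1 => [|i _]; last first.
  by rewrite !big_ord_recl big_ord0 /= term0l // term11 // term0r // !addr0.
rewrite /lambda_diff /= Omega_diff_top // !scaler0 !addr0.
by apply: bracket0r => [x|u //]; rewrite Omega_mul0r.
Qed.

(** The bracket adds cochain degrees and subtracts one, so components of degree at most 2 reach
    degree 3 at most. *)
Lemma MC_lhs_ge4 j m v : MC_lhs j m.+4 v = 0.
Proof.
rewrite /MC_lhs lambda_bracketE big1 => [|i _]; last first.
  apply: big1 => p _; case: (ltnP 2 p) => hp.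
    by rewrite term0l //; case: (val p) hp => [|[|[|q]]].
  rewrite term0r //; have -> : (m.+4.+1 - p = (m + (2 - p)).+3)%N by lia.
  by [].
rewrite /lambda_diff /= Omega_diff0 !scaler0 !addr0.
by apply: bracket0r => [x|u //]; rewrite Omega_mul0r.
Qed.

(** Write [db] for the coboundary of [b]. The Koszul sign makes the terms of degrees (1, 2) and (2,
    1) equal, so half the bracket is [a * db]. The differential contributes [db] minus the
    derivative of [a], and [db + a * db = (1 + a) * db]. *)
Lemma MC_lhs2 j v : MC_lhs j 2%N v = Omega_top (flow_defect v j).
Proof.
pose db := b (face 2 v) + b (face 0 v) - b (face 1 v).
have dbE l : db l = b (face 2 v) l + b (face 0 v) l - b (face 1 v) l by [].
have term12 i : MC_term j 2 v i 1%N 2%N = Omega_top (db i * a v (j - i)%N).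
  rewrite /MC_term bracket12 /= !koszul1_top // -!Omega_topN.
  rewrite !Omega_mul_top_const -!Omega_topD -Omega_topB; congr Omega_top.
  by rewrite !dbE; ring.
have term21 i : MC_term j 2 v i 2%N 1%N = Omega_top (a v i * db (j - i)%N).
  rewrite /MC_term bracket21 /= !koszul_id.
  rewrite !Omega_mul_const_top -!Omega_topD -Omega_topB; congr Omega_top.
  by rewrite !dbE; ring.
have termE (i : 'I_j.+1) : \sum_(p < 4) MC_term j 2 v i p (3 - p)%N =
    Omega_top (db i * a v (j - i)%N + a v i * db (j - i)%N).
  rewrite !big_ord_recl big_ord0 /= term0l // (@term0l _ _ _ _ 3) //.
  by rewrite term12 term21 add0r !addr0 Omega_topD.
have bracketE : lambda_bracket MC_series MC_series j 2%N v =
    Omega_top ((db * a v + a v * db) j).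
  rewrite lambda_bracketE (eq_bigr _ (fun i _ => termE i)) -raddf_sum.
  by rewrite fps_addE !fps_mulE -big_split.
have diffE : lambda_diff MC_series j 2%N v =
    Omega_top ((db - fps_map (fun p => \sum_(i < n) mderiv i p) (a v)) j).
  rewrite /lambda_diff bracket21 /= Omega_diff_const // expr1z scaleN1r /mS.
  by rewrite !Omega_mul_const_top !mul1r -Omega_topD -!Omega_topB.
rewrite /MC_lhs diffE bracketE -linearZ -Omega_topD; congr Omega_top.
rewrite (mulrC db) -mulr2n.
rewrite -[(_ *+ 2) j]/(((_ : fps _) j) *+ 2) -scaler_nat scalerA.
rewrite mulVf ?two_neq0 // scale1r.
have -> : flow_defect v =
    db - fps_map (fun p => \sum_(i < n) mderiv i p) (a v) + a v * db.
  by rewrite /flow_defect -/db; ring.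
by [].
Qed.

(** Only degrees (2, 2) contribute. Half the bracket gives the quadratic part of the expanded
    cocycle condition for [1 + a], the bracket with [mS] the linear part, and the constants
    cancel. *)
Lemma MC_lhs3 j v : MC_lhs j 3%N v = Omega_const (cocycle_defect v j).
Proof.
pose c0 := a (face 0 v); pose c1 := a (face 1 v).
pose c2 := a (face 2 v); pose c3 := a (face 3 v).
have termE (i : 'I_j.+1) : \sum_(p < 5) MC_term j 3 v i p (4 - p)%N =
    Omega_const (c1 i * c3 (j - i)%N - c2 i * c0 (j - i)%N
                 + (c3 i * c1 (j - i)%N - c0 i * c2 (j - i)%N)).
  rewrite !big_ord_recl big_ord0 /= term0l // (@term0r _ _ _ _ 1) //.
  rewrite (@term0l _ _ _ _ 3) //.
  rewrite (@term0l _ _ _ _ 4) // add0r !addr0 add0r.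
  rewrite /MC_term bracket22 /= !koszul_const !Omega_mul_const2.
  by rewrite -!Omega_constB -Omega_constD.
have bracketE : lambda_bracket MC_series MC_series j 3%N v =
    Omega_const ((c1 * c3 - c2 * c0 + (c3 * c1 - c0 * c2)) j).
  rewrite lambda_bracketE (eq_bigr _ (fun i _ => termE i)) -raddf_sum.
  rewrite !fps_addE !fps_oppE !fps_mulE -!sumrB -big_split.
  by congr Omega_const; apply: eq_bigr => i _.
have diffE : lambda_diff MC_series j 3%N v =
    Omega_const (c3 j - c0 j + (c1 j - c2 j)).
  rewrite /lambda_diff bracket22 /= Omega_diff0 scaler0 addr0 /mS.
  by rewrite !Omega_mul_const2 !mul1r -!Omega_constB -Omega_constD.
rewrite /MC_lhs diffE bracketE -linearZ -Omega_constD; congr Omega_const.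
rewrite (mulrC c3) (mulrC c0) -mulr2n.
rewrite -[(_ *+ 2) j]/(((_ : fps _) j) *+ 2) -scaler_nat scalerA.
rewrite mulVf ?two_neq0 // scale1r.
have -> : cocycle_defect v = (c3 - c0 + (c1 - c2)) + (c1 * c3 - c2 * c0).
  by rewrite /cocycle_defect -/c0 -/c1 -/c2 -/c3; ring.
by [].
Qed.

End MCEquation.
Arguments MC_series {disp P k n} a b _ _ _.

(** * Elements of degree 1 as pairs of a 2-cochain and a 1-cochain *)

Section SeriesMC.
Variables (disp : Order.disp_t) (P : porderType disp) (k : fieldType).
Variable n : nat.
Hypothesis n_le1 : (n <= 1)%N.

(** The finitely many monomial forms of polynomial degree below [d] span all values of [f],
    uniformly in [v]. Pairing each with its coefficient, as a function of [v], writes [f] as a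
    finite sum of pure tensors. *)
Lemma in_tensor_bounded (p d : nat) (f : cochain P (Omega k n) p) :
  (forall v S, (msize (f v S) <= d)%N) -> in_tensor f.
Proof.
move=> fd.
exists [seq (fun v => (f v Sm.1)@_(Sm.2),
             [ffun S => if S == Sm.1 then 'X_[Sm.2] else 0] : Omega k n)
       | Sm : {set 'I_n} * 'X_{1..n < d}].
move=> v; apply/ffunP => S; rewrite big_map big_enum /= sum_ffunE.
pose F (T : {set 'I_n}) (m : 'X_{1..n < d}) : {mpoly k[n]} :=
  (f v T)@_m *: (if S == T then 'X_[m] else 0).
transitivity (\sum_(Sm : {set 'I_n} * 'X_{1..n < d}) F Sm.1 Sm.2); last first.
  by apply: eq_bigr => Sm _; rewrite !ffunE.
rewrite -(pair_big xpredT xpredT F) /= (bigD1 S) //=.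
rewrite [X in _ + X]big1 => [|T neTS]; last first.
  by rewrite big1 // => m _; rewrite /F eq_sym (negPf neTS) scaler0.
rewrite addr0 [LHS](mpolywE (fd v S)).
by apply: eq_bigr => m _; rewrite /F eqxx.
Qed.

Lemma MC_series_in_gOmega (a : cochain P (fps {mpoly k[n]}) 2)
    (b : cochain P (fps {mpoly k[n]}) 1) :
    (forall v, a v 0%N = 0) -> (forall v, b v 0%N = 0) ->
    (forall v, graded (a v)) -> (forall v, graded (b v)) ->
  in_gOmega 1 (MC_series a b).
Proof.
move=> a0 b0 ga gb; split.
- by case=> [|[|[|p]]] v //=; rewrite ?a0 ?b0 raddf0.
- move=> j p; apply: (@in_tensor_bounded _ j.+1).
  case: p => [|[|[|p]]] v S; rewrite /= ffunE ?msize0 //; case: ifP => _;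
  by rewrite ?msize0 ?ga ?gb.
- move=> j [|[|[|p]]] v S; rewrite /= ffunE ?eqxx //; case: ifPn => // S0.
  + by rewrite eqxx.
  + by rewrite card_ord_le1.
  + by rewrite (eqP S0) cards0.
  + by rewrite eqxx.
Qed.

(** The degree condition [p - 1 + |S| = 1] with [|S|] at most 1 leaves only 2-cochains of functions
    and 1-cochains of 1-forms. *)
Lemma in_gOmega_series (c : lambda_series P k n) : in_gOmega 1 c ->
  c = MC_series (fun v j => c j 2%N v finset.set0)
                (fun v j => c j 1%N v [set: 'I_n]%SET).
Proof.
case=> _ _ deg; apply/funext => j; apply: functional_extensionality_dep => p.
have c0 v (S : {set 'I_n}) : (p%:Z - 1 + #|S|%:Z != 1) -> c j p v S = 0.
  by move=> pS; apply: contraNeq pS => /deg /eqP.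
apply/funext => v; apply/ffunP => S.
have [S0|S0] := eqVneq S finset.set0.
  case: p v c0 => [|[|[|p]]] v c0; rewrite /= ?ffunE ?S0 ?eqxx // c0 //;
  by rewrite cards0; lia.
case: p v c0 => [|[|[|p]]] v c0; rewrite /= ?ffunE ?(negPf S0) //.
- by rewrite c0 // card_ord_le1.
- by rewrite (set_ord_le1 n_le1 S0).
- by rewrite c0 // card_ord_le1.
- by rewrite c0 // card_ord_le1 //; lia.
Qed.

Hypothesis k_char0 : [pchar k] =i pred0.

(** Only cochain degrees 2 and 3 impose conditions. The flow condition is kept under [Omega_top],
    which makes it vacuous for [n = 0]. *)
Lemma maurer_cartan_series (a : cochain P (fps {mpoly k[n]}) 2)
    (b : cochain P (fps {mpoly k[n]}) 1) :
  maurer_cartan (MC_series a b) <->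
  [/\ in_gOmega 1 (MC_series a b), forall v, cocycle_defect a v = 0 &
      forall v j, Omega_top (flow_defect a b v j) = 0].
Proof.
split=> [[gc mc]|[gc c0 f0]]; split=> //.
- move=> v; apply/funext => j; have := mc j 3%N v.
  rewrite -/(MC_lhs a b j v) MC_lhs3 // => /ffunP/(_ finset.set0).
  by rewrite !ffunE eqxx.
- by move=> v j; rewrite -(MC_lhs2 k_char0 n_le1); apply: mc.
- move=> j [|[|[|[|p]]]] v; rewrite -/(MC_lhs a b j v).
  + exact: MC_lhs0.
  + exact: MC_lhs1.
  + by rewrite MC_lhs2.
  + by rewrite MC_lhs3 // c0 raddf0.
  + exact: MC_lhs_ge4.
Qed.

End SeriesMC.

(** * Vertices, and the end points of edges *)

Section Vertices.
Variables (disp : Order.disp_t) (P : porderType disp) (k : fieldType).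

(** A vertex is parametrized by [f = 1 + a] instead of [a], to match cochains with values in W. *)
Definition MC_const (f : simplex P 2 -> fps k) : lambda_series P k 0 :=
  MC_series (fun v => fps_map (@mpolyC 0 k) (f v) - 1) (fun=> 0).

(** Polynomials in no variables are constants, so the evaluation merely identifies them with
    elements of [k]. *)
Definition MC_coef (x : lambda_series P k 0) (v : simplex P 2) : fps k :=
  let a : fps {mpoly k[0]} := fun j => x j 2%N v finset.set0 in
  fps_map (meval (fun=> 0)) (1 + a).

Lemma MC_constK : cancel MC_const MC_coef.
Proof.
move=> f; apply/funext => v; apply/funext => j; rewrite /MC_coef /fps_map /=.
rewrite fps_addE ffunE eqxx /= fps_addE fps_oppE addrA addrAC subrr add0r.
exact: mevalC.
Qed.

Lemma mpoly0_eval (p : {mpoly k[0]}) (t : 'I_0 -> k) : p = (p.@[t])%:MP.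
Proof. by rewrite -[p]mpolyKC mevalC. Qed.

Lemma MC_series_const (a : cochain P (fps {mpoly k[0]}) 2) b :
  MC_series a b = MC_const (fun v => fps_map (meval (fun=> 0)) (1 + a v)).
Proof.
apply/funext => j; apply: functional_extensionality_dep => -[|[|[|p]]] //.
  apply/funext => v; apply/ffunP => S; rewrite !ffunE; case: ifP => // /negP[].
  by apply/eqP/setP => -[].
apply/funext => v; congr Omega_const; rewrite fps_addE fps_oppE /fps_map.
rewrite fps_addE mevalD mpolyCD -!mpoly0_eval.
by rewrite addrAC subrr add0r.
Qed.

Lemma MC_const_coef (x : MC P k 0) : MC_const (MC_coef x) = x.
Proof.
case: x => x /= /asboolP[/in_gOmega_series gx _].
by rewrite [in RHS]gx // MC_series_const.
Qed.

Lemma MC_coef0 (x : MC P k 0) v : MC_coef x v 0%N = 1.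
Proof.
case: x => x /= /asboolP[[x0 _ _] _].
by rewrite /MC_coef /fps_map fps_addE x0 ffunE fps_oneE addr0 meval1.
Qed.

(** Differentials vanish on a point, which removes the 1-form part. On functions the pullback is
    evaluation at the vertex chosen by [th], where [t_1] is 1 if that vertex is the last one and 0
    otherwise. *)
Lemma Omega_map01 (th : 'I_1 -> 'I_2) (w : Omega k 1) :
  Omega_map th w =
  Omega_const ((w finset.set0).@[fun=> (th ord0 == ord_max)%:R])%:MP.
Proof.
rewrite /Omega_map (bigD1 finset.set0) //= big1 => [|S S0]; last first.
  have d0 q : Omega_diff (Omega_const q : Omega k 0) = 0.
    by apply/ffunP => T; rewrite !ffunE big1 // => -[].
  have [i iS] := set0Pn _ S0.
  rewrite (_ : \big[_/_]_(i in S) _ = 0) ?Omega_mul0r //.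
  have : i \in index_enum 'I_1 by exact: mem_index_enum.
  elim: index_enum => // l r IH; rewrite big_cons d0 Omega_mul0l inE.
  by case: ifPn => // lS /predU1P[il|/IH//]; rewrite -il iS in lS.
rewrite addr0 big_set0 Omega_mul_const2 mulr1; congr Omega_const.
rewrite [LHS](mpoly0_eval _ (fun=> 0)) comp_mpoly_meval; congr (_%:MP).
apply: meval_eq => i; rewrite tnth_mktuple /bary_coord_pull big_mkcond big_ord1.
have -> : lift ord0 i = ord_max by apply: val_inj; case: i => -[].
case: eqP => _; last by rewrite meval0.
by rewrite /bary_coord unlift_none big_ord0 subr0 meval1.
Qed.

Lemma lambda_map01 (th : 'I_1 -> 'I_2) (a : cochain P (fps {mpoly k[1]}) 2) b :
  lambda_map th (MC_series a b) = MC_const (fun v =>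
    fps_map (meval (fun=> (th ord0 == ord_max)%:R)) (1 + a v)).
Proof.
apply/funext => j; apply: functional_extensionality_dep => -[|[|[|p]]];
  apply/funext => v; rewrite /lambda_map Omega_map01 /= ffunE.
- by rewrite meval0 mpolyC0 raddf0.
- by rewrite eqxx meval0 mpolyC0 !raddf0.
- rewrite eqxx; congr Omega_const; rewrite fps_addE fps_oppE /fps_map.
  rewrite fps_addE mevalD mpolyCD fps_oneE.
  by case: j => [|j]; rewrite /= ?meval1 ?meval0 ?mpolyC1 ?mpolyC0;
  rewrite addrAC subrr add0r.
- by rewrite meval0 mpolyC0 raddf0.
Qed.

End Vertices.

(** * Cochains with values in W, in multiplicative form *)

Section WittCochains.
Variables (disp : Order.disp_t) (P : porderType disp) (k : fieldType).
Implicit Types f g : cochain P (witt k) 2.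

Definition witt_fps (x : witt k) : fps k := wcoef x.

Lemma witt_fps_inj : injective witt_fps.
Proof. by move=> x y xy; apply: val_inj. Qed.

Lemma witt_fpsD x y : witt_fps (x + y) = witt_fps x * witt_fps y.
Proof. by []. Qed.

Lemma witt_fps0 x : witt_fps x 0%N = 1.
Proof. exact/eqP/wcoefP. Qed.

Lemma delta1E (w : cochain P (witt k) 1) v :
  delta w v = w (face 0 v) + w (face 2 v) - w (face 1 v).
Proof.
rewrite /delta !big_ord_recl big_ord0 /= addr0.
rewrite !exprS expr0 !mulr1 ?mulrNN ?mulr1 ?mulrN1z ?mulr1z.
by rewrite addrCA addrC.
Qed.

Lemma delta2E f v :
  delta f v = f (face 0 v) + f (face 2 v) - (f (face 1 v) + f (face 3 v)).
Proof.
rewrite /delta !big_ord_recl big_ord0 /= addr0.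
rewrite !exprS expr0 !mulr1 ?mulrNN ?mulr1 ?mulrN1 ?mulrN1z ?mulr1z. 
by rewrite opprD addrA addrACA.
Qed.

Lemma is_cocycleP f : f \in @is_cocycle _ P (witt k) 2 <->
  forall v, witt_fps (f (face 1 v)) * witt_fps (f (face 3 v)) =
            witt_fps (f (face 2 v)) * witt_fps (f (face 0 v)).
Proof.
rewrite /in_mem /= /is_cocycle; split=> [/eqP df v|df].
  have /eqP := congr1 (fun h => h v) df; rewrite delta2E subr_eq0 => /eqP E.
  by rewrite -!witt_fpsD -E addrC.
apply/eqP/funext => v; rewrite delta2E; apply/eqP; rewrite subr_eq0; apply/eqP.
by apply: witt_fps_inj; rewrite !witt_fpsD df mulrC.
Qed.

End WittCochains.

(** A simplicial identity: [bump j.+1] after [bump i] is [bump i] after [bump j]. The inner index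
    stays in range, so the inner clamp of [reindex] does nothing. *)
Lemma face_face (disp : Order.disp_t) (P : porderType disp) (n i j : nat)
    (v : simplex P n.+2) :
  (i <= j)%N -> face i (face j.+1 v) = face j (face i v).
Proof.
move=> ij; apply: val_inj; apply: eq_from_tnth => l; rewrite !tnth_mktuple.
have small h : (bump h l <= n.+1)%N.
  by apply: (@leq_add _ _ 1 n); rewrite ?leq_b1 // -ltnS.
rewrite !inordK ?ltnS ?geq_minl // !(minn_idPr (small _)).
by congr (tnth _ (inord (minn _ _))); rewrite /bump; lia.
Qed.

(** * Edges correspond to coboundaries *)

Section Edges.
Variables (disp : Order.disp_t) (P : porderType disp) (k : fieldType).
Hypothesis k_char0 : [pchar k] =i pred0.
Implicit Types f g : cochain P (witt k) 2.

Lemma fps_map_mpolyCK n (t : 'I_n -> k) :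
  cancel (fps_map (@mpolyC n k)) (fps_map (meval t)).
Proof. by move=> f; apply/funext => j; rewrite /fps_map mevalC. Qed.

Lemma fps_deriv_const n (i : 'I_n) (f : fps k) :
  fps_map (mderiv i) (fps_map (@mpolyC n k) f) = 0.
Proof. by apply/funext => j; rewrite /fps_map mderivC. Qed.

Lemma fps_deriv_sum1 (f : fps {mpoly k[1]}) :
  fps_map (fun p => \sum_(i < 1) mderiv i p) f = fps_map (mderiv ord0) f.
Proof. by apply/funext => j; rewrite /fps_map big_ord1. Qed.

Lemma graded1 n : @graded k n 1.
Proof. by rewrite -(rmorph1 (fps_map (@mpolyC n k))); apply: graded_const. Qed.

Lemma maurer_cartan_witt f :
  maurer_cartan (MC_const (fun v => witt_fps (f v))) <->
  f \in @is_cocycle _ P (witt k) 2.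
Proof.
pose C := fps_map (@mpolyC 0 k).
have defect v : cocycle_defect (fun v => C (witt_fps (f v)) - 1) v =
    C (witt_fps (f (face 1 v)) * witt_fps (f (face 3 v))
       - witt_fps (f (face 2 v)) * witt_fps (f (face 0 v))).
  rewrite /cocycle_defect !(addrC 1) !subrK /C.
  by rewrite rmorphB !rmorphM.
rewrite maurer_cartan_series // is_cocycleP; split=> [[_ mc _] v|fc].
  apply/eqP; rewrite -subr_eq0; apply/eqP; have := mc v; rewrite defect.
  by move/(congr1 (fps_map (meval (fun=> 0)))); rewrite fps_map_mpolyCK rmorph0.
split=> [|v|v j].
- apply: MC_series_in_gOmega => // v.
  + by rewrite fps_addE fps_oppE /fps_map witt_fps0 mpolyC1 subrr.
  + apply: gradedB; [exact: graded_const|exact: graded1].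
  + by move=> j; rewrite msize0.
- by rewrite defect fc subrr /C rmorph0.
- apply/ffunP => S; rewrite !ffunE; case: ifP => // /negP[].
  by apply/eqP/setP => -[].
Qed.

(** This is [g = f] times the multiplicative coboundary of [w], cleared of its denominator. *)
Definition cohomologous f g : Prop := exists w : cochain P (witt k) 1,
  forall v,
    witt_fps (f v) * (witt_fps (w (face 0 v)) * witt_fps (w (face 2 v))) =
    witt_fps (g v) * witt_fps (w (face 1 v)).

Definition joined_by_edge f g : Prop := exists c : MC P k 1,
  MC_face ord_max c = MC_const (fun v => witt_fps (f v)) /\
  MC_face ord0 c = MC_const (fun v => witt_fps (g v)).

Lemma lift_max_eq : (lift (ord_max : 'I_2) (ord0 : 'I_1) == ord_max) = false.
Proof. by []. Qed.

Lemma lift0_eq : (lift (ord0 : 'I_2) (ord0 : 'I_1) == ord_max) = true.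
Proof. by []. Qed.

(* The 1-cochain is exp (int_0^1 b dt), where b dt is the part of the edge in
   degree 1 over the interval. *)
Lemma edge_cohomologous f g : joined_by_edge f g -> cohomologous f g.
Proof.
case=> -[c /= /asboolP mc] [cf cg]; have [[c0 _ _] _] := mc.
have cE := in_gOmega_series (leqnn 1) mc.1.
set a : simplex P 2 -> fps {mpoly k[1]} := fun v j => _ in cE.
set b : simplex P 1 -> fps {mpoly k[1]} := fun v j => _ in cE.
have b0 e : b e 0%N = 0 by rewrite /b c0 ffunE.
move: mc; rewrite cE maurer_cartan_series // => -[_ _ flow].
move: cf cg; rewrite /MC_face cE !lambda_map01 lift_max_eq lift0_eq.
move=> /(can_inj (@MC_constK _ P k)) af /(can_inj (@MC_constK _ P k)) ag.
have {}af v : fps_map (meval (fun=> 0)) (1 + a v) = witt_fps (f v).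
  exact: (congr1 (fun h => h v) af).
have {}ag v : fps_map (meval (fun=> 1)) (1 + a v) = witt_fps (g v).
  exact: (congr1 (fun h => h v) ag).
have {}flow v : fps_map (mderiv ord0) (1 + a v) =
    (1 + a v) * (b (face 2 v) + b (face 0 v) - b (face 1 v)).
  rewrite fps_derivD fps_deriv1 add0r; apply/eqP; rewrite eq_sym -subr_eq0.
  apply/eqP/funext => j; have := flow v j; rewrite /flow_defect fps_deriv_sum1.
  move/ffunP/(_ [set: 'I_1]%SET); rewrite !ffunE ifN //.
  by apply/set0Pn; exists ord0; rewrite finset.in_setT.
pose u e := projT1 (cid (fps_ode_sol k_char0 (fun=> 0) (b0 e))).
have uP e : [/\ u e 0%N = 1, fps_map (mderiv ord0) (u e) = u e * b e &
    fps_map (meval (fun=> 0)) (u e) = 1] by rewrite /u; case: cid.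
have w0 e : fps_map (meval (fun=> 1)) (u e) 0%N == 1.
  by have [u0 _ _] := uP e; rewrite /fps_map u0 meval1.
exists (fun e => Witt (w0 e)) => v.
pose F := fps_map (@mpolyC 1 k) (witt_fps (f v)).
(* With the denominator cleared, both products solve [y' = y * db]: in the derivative of the second
   one the terms in [b (face 1 v)] cancel. Both equal [f] at [t = 0], so their difference vanishes
   by uniqueness; evaluating at [t = 1] then gives the claim. *)
have : F * (u (face 0 v) * u (face 2 v)) - (1 + a v) * u (face 1 v) = 0.
  pose db := b (face 0 v) + b (face 2 v).
  apply: (fps_ode_eq0 k_char0 (b := db) (t0 := fun=> 0)).
  - by rewrite /db fps_addE !b0 addr0.
  - rewrite fps_derivD fps_derivN !fps_derivM flow fps_deriv_const.
    have [_ -> _] := uP (face 0 v); have [_ -> _] := uP (face 1 v).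
    by have [_ -> _] := uP (face 2 v); rewrite /db; ring.
  - rewrite rmorphB !rmorphM /= af fps_map_mpolyCK.
    have [_ _ ->] := uP (face 0 v); have [_ _ ->] := uP (face 1 v).
    by have [_ _ ->] := uP (face 2 v); rewrite !mulr1 subrr.
move/(congr1 (fps_map (meval (fun=> 1)))); rewrite rmorph0 rmorphB !rmorphM /=.
by rewrite ag fps_map_mpolyCK => /eqP; rewrite subr_eq0 => /eqP.
Qed.

Lemma cohomologous_edge f g : f \in @is_cocycle _ P (witt k) 2 ->
  cohomologous f g -> joined_by_edge f g.
Proof.
move=> /is_cocycleP fc [w wE].
pose F v := fps_map (@mpolyC 1 k) (witt_fps (f v)).
pose u e := fps_path (witt_fps (w e)).
have invP e : exists i, [/\ i 0%N = 1, u e * i = 1 & graded i].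
  by apply: graded_inv (graded_path _).
pose i e := projT1 (cid (invP e)).
have iP e : [/\ i e 0%N = 1, u e * i e = 1 & graded (i e)].
  by rewrite /i; case: cid.
have ui e : u e * i e = 1 by case: (iP e).
(* [m] is [f] times the coboundary of the path [u], with [i] the inverse of [u], and [b] below is
   the logarithmic derivative of [u]. *)
pose m v := F v * u (face 0 v) * u (face 2 v) * i (face 1 v).
pose a v := m v - 1.
pose b e := fps_map (mderiv ord0) (u e) * i e.
have mE v : 1 + a v = m v by rewrite addrC subrK.
have m0 v : m v 0%N = 1.
  rewrite /m !fps_mul0E; have [-> _ _] := iP (face 1 v).
  by rewrite /F /fps_map witt_fps0 mpolyC1 !mulr1.
have gm v : graded (m v).
  have [_ _ gi] := iP (face 1 v); apply: gradedM gi.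
  apply: gradedM (graded_path _).
  by apply: gradedM (graded_path _); apply: graded_const.
have mc : maurer_cartan (MC_series a b).
  apply/maurer_cartan_series => //; split=> [|v|v j].
  - apply: MC_series_in_gOmega => // [v|e|v|e].
    + by rewrite /a fps_addE m0 fps_oppE subrr.
    + by rewrite /b fps_mul0E deriv_path0 mul0r.
    + apply: gradedB; [exact: gm|exact: graded1].
    + by have [_ _ gi] := iP e; apply: gradedM (graded_deriv_path _) gi.
  - rewrite /cocycle_defect !mE /m.
    have := congr1 (fps_map (@mpolyC 1 k)) (fc v).
    rewrite !rmorphM -!/(F _) => Fv.
    (* The coboundary of a coboundary is trivial: after the simplicial identities, each side is its
       product of two values of [F], times one cancelling pair [u * i], times the same four
       remaining factors. *)
    rewrite (@face_face _ _ _ 0 0) // (@face_face _ _ _ 0 2) //.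
    rewrite (@face_face _ _ _ 0 1) // (@face_face _ _ _ 1 1) //.
    rewrite (@face_face _ _ _ 1 2) // (@face_face _ _ _ 2 2) //.
    have u21 := ui (face 2 (face 1 v)); have u10 := ui (face 1 (face 0 v)).
    rewrite [X in X - _](_ : _ = F (face 1 v) * F (face 3 v)
      * (u (face 2 (face 1 v)) * i (face 2 (face 1 v)))
      * (u (face 0 (face 0 v)) * i (face 1 (face 1 v))
         * u (face 2 (face 0 v)) * u (face 2 (face 2 v)))); last by ring.
    rewrite [X in _ - X](_ : _ = F (face 2 v) * F (face 0 v)
      * (u (face 1 (face 0 v)) * i (face 1 (face 0 v)))
      * (u (face 0 (face 0 v)) * i (face 1 (face 1 v))
         * u (face 2 (face 0 v)) * u (face 2 (face 2 v)))); last by ring.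
    by rewrite u21 u10 Fv subrr.
  - suff -> : flow_defect a b v = 0 by exact: (raddf0 (@Omega_top k 1)).
    rewrite /flow_defect fps_deriv_sum1 mE.
    have -> : fps_map (mderiv ord0) (a v) = fps_map (mderiv ord0) (m v).
      by rewrite -mE [RHS]fps_derivD fps_deriv1 add0r.
    (* Differentiate [u e * i e = 1] and multiply by [i e]. *)
    have Di e : fps_map (mderiv ord0) (i e) = - (b e * i e).
      have /eqP := congr1 (fps_map (mderiv ord0)) (ui e).
      rewrite fps_derivM fps_deriv1 addrC addr_eq0 => /eqP Du.
      by rewrite -[LHS]mul1r -(ui e) mulrAC Du /b mulNr mulrAC.
    have Du e : fps_map (mderiv ord0) (u e) = u e * b e.
      by rewrite /b mulrCA ui mulr1.
    by rewrite /m !fps_derivM fps_deriv_const Di !Du; ring.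
exists (MkMC (introT (asboolP _) mc)); rewrite /MC_face /= !lambda_map01.
rewrite lift_max_eq lift0_eq.
have evi s e : fps_map (meval (fun=> s)) (u e)
    * fps_map (meval (fun=> s)) (i e) = 1.
  by rewrite -rmorphM ui rmorph1.
(* The path [u] runs from 1 to [w], so [m] runs from [f] to [f] times the coboundary of [w], which
   is [g]. *)
split; congr MC_const; apply/funext => v;
  rewrite mE /m !rmorphM /= fps_map_mpolyCK.
  have := evi 0 (face 1 v); rewrite !path_eval0 mul1r => ->.
  by rewrite !mulr1.
have := evi 1 (face 1 v); rewrite !path_eval1 ?witt_fps0 // => wi.
by rewrite -(mulrA (witt_fps (f v))) wE -mulrA wi mulr1.
Qed.

End Edges.

(** * Comparison of the moduli space with cohomology classes *)

Section Moduli.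
Variables (disp : Order.disp_t) (P : porderType disp) (k : fieldType).
Hypothesis k_char0 : [pchar k] =i pred0.

Definition MC_witt (x : MC P k 0) : cochain P (witt k) 2 :=
  fun v => Witt (introT eqP (MC_coef0 x v)).

Lemma MC_const_witt (x : MC P k 0) :
  MC_const (fun v => witt_fps (MC_witt x v)) = x.
Proof. exact: MC_const_coef. Qed.

Lemma MC_witt_cocycle (x : MC P k 0) : MC_witt x \in @is_cocycle _ P (witt k) 2.
Proof.
apply/(maurer_cartan_witt k_char0); rewrite MC_const_witt.
exact/asboolP/MCP.
Qed.

Definition cocycle_of_MC (x : MC P k 0) : @cocycle _ P (witt k) 2 :=
  Cocycle (MC_witt_cocycle x).

Lemma maurer_cartan_cocycle (f : @cocycle _ P (witt k) 2) :
  `[< maurer_cartan (MC_const (fun v => witt_fps (f v))) >].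
Proof.
by apply/asboolP/(maurer_cartan_witt k_char0)/cocycleP.
Qed.

Definition MC_of_cocycle (f : @cocycle _ P (witt k) 2) : MC P k 0 :=
  MkMC (maurer_cartan_cocycle f).

Lemma MC_of_cocycleK : cancel MC_of_cocycle cocycle_of_MC.
Proof.
move=> f; apply: val_inj; apply/funext => v; apply: val_inj.
exact: (congr1 (fun h => h v) (MC_constK _)).
Qed.

Definition cohomology_class (f : @cocycle _ P (witt k) 2) :
    cohomology P (witt k) 2 :=
  \pi_(cohomology P (witt k) 2)%qT f.

(** Equality of classes means that [g - f] is a coboundary. Moving negative terms across turns this
    into an equality of sums in W, that is, of products of power series. *)
Lemma cohomology_classP (f g : @cocycle _ P (witt k) 2) :
  reflect (cohomologous f g) (cohomology_class f == cohomology_class g).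
Proof.
rewrite eq_sym -Quotient.idealrBE.
have subE (V : zmodType) (a b c d : V) : (a - b == c - d) = (d + a == c + b).
  by rewrite subr_eq addrAC eq_sym subr_eq eq_sym (addrC d).
have valE v : (g - f) v = g v - f v by [].
apply: (iffP (asboolP _)) => -[w wE]; exists w.
  move=> v; rewrite -!witt_fpsD; congr witt_fps; apply/eqP.
  by rewrite -subE -valE -delta1E wE.
apply/funext => v; rewrite delta1E valE; apply/eqP; rewrite subE; apply/eqP.
by apply: witt_fps_inj; apply: wE.
Qed.

Lemma MC_edgeP (x y : MC P k 0) :
  MC_edge x y <-> joined_by_edge (cocycle_of_MC x) (cocycle_of_MC y).
Proof. by rewrite /joined_by_edge !MC_const_witt. Qed.

(** Equality of classes is an equivalence relation containing the edges, hence also the relation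
    they generate. Conversely, a single edge joins vertices of the same class. *)
Lemma MC_connectedP (x y : MC P k 0) : MC_connected x y <->
  cohomology_class (cocycle_of_MC x) = cohomology_class (cocycle_of_MC y).
Proof.
split=> [/asboolP|/eqP/cohomology_classP xy].
  elim=> [{}x {}y /MC_edgeP xy|//|{}x {}y _ -> //|{}x {}y z _ -> _ -> //].
  exact/eqP/cohomology_classP/edge_cohomologous.
by apply/asboolP/rst_step/MC_edgeP/cohomologous_edge => //; apply: cocycleP.
Qed.

End Moduli.

Theorem theorem3p7 (k : fieldType) (k_char0 : [pchar k] =i pred0)
    (disp : Order.disp_t) (P : porderType disp) (P_fin : locally_finite P) :
  exists phi : MCmoduli P k -> cohomology P (witt k) 2,
    bijective phi /\ phi (MCmoduli_base P k) = 0.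
Proof.
pose Z := @cocycle_of_MC _ P k k_char0.
exists (fun q => cohomology_class (Z (repr q))).
(* The map is defined through chosen representatives; connected vertices have the same class, so the
   choice does not matter. *)
have piE x : cohomology_class (Z (repr (\pi_(MCmoduli P k) x)%qT)) =
    cohomology_class (Z x).
  by apply/(MC_connectedP k_char0)/eqmodP; rewrite reprK.
split.
  exists (fun h => (\pi_(MCmoduli P k) (MC_of_cocycle k_char0 (repr h)))%qT).
    move=> q; rewrite -[RHS]reprK; apply/eqmodP/(MC_connectedP k_char0).
    by rewrite MC_of_cocycleK /cohomology_class reprK.
  by move=> h; rewrite piE /Z MC_of_cocycleK /cohomology_class reprK.
(* The base point [a = 0] gives the constant cochain with value the series 1, the zero element of
   [witt k]. *)
rewrite piE (_ : Z _ = 0).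
  exact: (raddf0 \pi_(cohomology P (witt k) 2)%qT).
apply: val_inj; apply/funext => v; apply: val_inj; apply/funext => j.
rewrite /= /MC_coef /fps_map /= fps_addE ffunE addr0 fps_oneE rmorph_nat.
by [].
Qed.
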